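(* Let $\xi\in L^0(\Omega,\mathcal F,Q;\mathbb R^d)$, $f:\mathcal P(\mathbb R^d)\to\mathbb R$, $L\in\mathcal L^Q$, and suppose $F_{Q_L}:\mathcal L^{Q_L}\to\mathbb R$, $F_{Q_L}(L')=f((L'Q_L)_\xi)$, is differentiable at $L_0=1$. Then there exists a bounded Borel function $g:\mathbb R^d\to\mathbb R$ such that $DF_{Q_L}(1)=g(\xi)$, $Q$-a.s. Moreover $g$ depends on $(Q,L,\xi)$ only through $(Q_L)_\xi$, in the following sense: if $Q'$ is any probability measure on $(\Omega,\mathcal F)$, $L'\in\mathcal L^{Q'}$ and $\xi'\in L^0(\Omega,\mathcal F,Q';\mathbb R^d)$ satisfy $(L'Q')_{\xi'}=(LQ)_\xi$, then $\widehat L'\mapsto f((\widehat L'Q'_{L'})_{\xi'})$, $\widehat L'\in\mathcal L^{Q'_{L'}}$, is differentiable at $1$ and its derivative equals $g(\xi')$, $Q'_{L'}$-a.s. (Consequently one writes $\partial_1F((Q_L)_\xi,x):=g(x)$.)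
   Context: $(\Omega,\mathcal B(\Omega))$ is a Radon space, $Q$ a probability measure on it, $\mathcal F=\mathcal B(\Omega)\vee\mathcal N_Q$. For any probability $Q'$ on $(\Omega,\mathcal F)$: $L^p_0(Q'):=\{\eta\in L^p(Q'):E^{Q'}[\eta]=0\}$, $\mathcal L^{Q'}:=\{L\in L^1(Q'):\ L>0\ Q'\text{-a.s.},\ E^{Q'}[L]=1\}$, $Q'_L:=LQ'$, $(LQ')_\xi$ is the law of $\xi$ under $LQ'$ ($\int\varphi\,d(LQ')_\xi=E^{Q'}[L\varphi(\xi)]$), and $F_{Q'}(L):=f((LQ')_\xi)$. $F_{Q'}$ is differentiable at $L$ if there is a continuous linear $(DF_{Q'})(L):L^1_0(Q')\to\mathbb R$ with $F_{Q'}(L'')-F_{Q'}(L)=(DF_{Q'})(L)(L''-L)+o(|L''-L|_{L^1(Q')})$ for $L''\in\mathcal L^{Q'}$, $|L''-L|_{L^1(Q')}\to0$; it is identified with the unique $DF_{Q'}(L)\in L^\infty_0(Q')$ such that $(DF_{Q'})(L)(\eta)=E^{Q'}[DF_{Q'}(L)\eta]$. *)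

(* Defs.v *)
From HB Require Import structures.
From mathcomp Require Import all_boot all_order all_algebra.
From mathcomp Require Import all_classical all_reals all_analysis.
Set Implicit Arguments. Unset Strict Implicit. Unset Printing Implicit Defensive.
Import Order.TTheory GRing.Theory Num.Theory.
Import numFieldNormedType.Exports.
Local Open Scope classical_set_scope.
Local Open Scope ring_scope.

HB.structure Definition TopMeasurable d := {T of Topological T & Measurable d T}.
Notation topMeasurableType d := (TopMeasurable.type d).

Definition borel_sets (T : topologicalType) : set (set T) := <<s @open T >>.

Notation Rd R d := (g_sigma_algebraType (@open 'rV[R]_d)).

Definition radon_space (R : realType) (T : ptopologicalType) : Prop :=
  hausdorff_space T /\
  forall (mu : probability (g_sigma_algebraType (@open T)) R) (B : set T),
    @borel_sets T B ->
    mu B = ereal_sup [set mu K | K in [set K : set T | compact K /\ K `<=` B]].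

Definition completion_of_borel d (R : realType) (T : topMeasurableType d)
  (Q : probability T R) : Prop :=
  forall A : set T, measurable A <->
    exists B N : set T, [/\ @borel_sets T B, @borel_sets T N, Q N = 0%E &
                          (A `\` B) `|` (B `\` A) `<=` N].

Definition l1dist d (R : realType) (T : measurableType d)
  (P : {measure set T -> \bar R}) (L1 L2 : T -> R) : \bar R :=
  (\int[P]_x (`|L1 x - L2 x|)%:E)%E.

Definition L1_0 d (R : realType) (T : measurableType d)
  (P : {measure set T -> \bar R}) : set (T -> R) :=
  [set eta | P.-integrable setT (EFin \o eta) /\ (\int[P]_x (eta x)%:E = 0)%E].

Definition densities d (R : realType) (T : measurableType d)
  (P : {measure set T -> \bar R}) : set (T -> R) :=
  [set L | [/\ P.-integrable setT (EFin \o L), {ae P, forall x, 0 < L x}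
           & (\int[P]_x (L x)%:E = 1)%E]].

Definition is_law d (R : realType) (T : measurableType d) (n : nat)
  (P : {measure set T -> \bar R}) (L : T -> R) (xi : T -> 'rV[R]_n)
  (nu : probability (Rd R n) R) : Prop :=
  forall A : set (Rd R n), measurable A ->
    nu A = (\int[P]_(x in xi @^-1` A) (L x)%:E)%E.

(* D : L^1_0(P) -> R is a continuous linear functional (D is a function on
   all of T -> R, only its values on L^1_0(P) matter; it is required to be
   compatible with P-a.e. equality, as L^1_0(P) consists of classes). *)
Definition cont_linear_L1_0 d (R : realType) (T : measurableType d)
  (P : {measure set T -> \bar R}) (D : (T -> R) -> R) : Prop :=
  [/\ (forall eta1 eta2, L1_0 P eta1 -> L1_0 P eta2 ->
         {ae P, forall x, eta1 x = eta2 x} -> D eta1 = D eta2),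
      (forall (a b : R) eta1 eta2, L1_0 P eta1 -> L1_0 P eta2 ->
         D (fun x => a * eta1 x + b * eta2 x) = a * D eta1 + b * D eta2) &
      exists C : R, forall eta, L1_0 P eta ->
         (`|D eta|%:E <= C%:E * l1dist P eta (fun=> 0%R))%E].

Definition is_derivative d (R : realType) (T : measurableType d) (n : nat)
  (P : {measure set T -> \bar R}) (xi : T -> 'rV[R]_n)
  (f : probability (Rd R n) R -> R) (L0 : T -> R) (D : (T -> R) -> R) : Prop :=
  cont_linear_L1_0 P D /\
  forall eps : R, 0 < eps -> exists2 delta : R, 0 < delta &
    forall L'', densities P L'' -> (l1dist P L'' L0 < delta%:E)%E ->
    forall nu'' nu0, is_law P L'' xi nu'' -> is_law P L0 xi nu0 ->
      (`|f nu'' - f nu0 - D (fun x => L'' x - L0 x)|%:E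
         <= eps%:E * l1dist P L'' L0)%E.

Definition differentiable_at d (R : realType) (T : measurableType d) (n : nat)
  (P : {measure set T -> \bar R}) (xi : T -> 'rV[R]_n)
  (f : probability (Rd R n) R -> R) (L0 : T -> R) : Prop :=
  exists D, is_derivative P xi f L0 D.

(* F_P is differentiable at L0 and its derivative, identified with the unique
   element DF_P(L0) of L^infty_0(P) representing it, equals h (P-a.s.). *)
Definition derivative_is d (R : realType) (T : measurableType d) (n : nat)
  (P : {measure set T -> \bar R}) (xi : T -> 'rV[R]_n)
  (f : probability (Rd R n) R -> R) (L0 : T -> R) (h : T -> R) : Prop :=
  [/\ differentiable_at P xi f L0,
      measurable_fun setT h /\ exists M : R, {ae P, forall x, `|h x| <= M},
      (\int[P]_x (h x)%:E = 0)%E &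
      forall D, is_derivative P xi f L0 D ->
        forall eta, L1_0 P eta -> (D eta)%:E = (\int[P]_x (h x * eta x)%:E)%E].

(* Main.v *)
(** Let mu be the law of xi under P = L Q.  Composing the derivative D with xi
    gives a continuous linear functional on L^1_0(mu); it is integration
    against a bounded g, the Radon-Nikodym derivative w.r.t. mu of the charge
    A |-> D(1_A(xi) - mu(A)), which is bounded by a multiple of mu.  For
    another pair (P', xi') with the same law mu and a density L'' of P',
    let h be the density w.r.t. mu of the law nu of xi' under L'' P'.  Then nu
    is also the law of xi under h(xi) P, the L^1 distance from h(xi) to 1 is at most that
    from L'' to 1 (h(xi') is the conditional expectation of L'' given xi'), and
    the integral of g (h - 1) under mu is that of g(xi') (L'' - 1) under P'.
    Hence the expansion of f at mu along h(xi) is an expansion along L''. *)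
Require Import Defs.
From HB Require Import structures.
From mathcomp Require Import all_boot all_order all_algebra.
From mathcomp Require Import all_classical all_reals all_analysis.
From mathcomp Require Import measurable_realfun lra.
Set Implicit Arguments. Unset Strict Implicit. Unset Printing Implicit Defensive.
Import Order.TTheory GRing.Theory Num.Theory.
Import numFieldNormedType.Exports.
Local Open Scope classical_set_scope.
Local Open Scope ring_scope.

(** * Integrability and real-valued integrals under a probability *)

Section bounded_functions.
Context d (T : measurableType d) (R : realType) (P : probability T R).

Lemma bounded_funP (g : T -> R) (M : R) :
  (forall x, `|g x| <= M) -> [bounded g x | x in setT].
Proof.
move=> gM; exists M; split; first exact: num_real.
by move=> y /ltW My x _; exact: le_trans My.
Qed.

Lemma integrable_bounded (g : T -> R) (M : R) :
  measurable_fun setT g -> (forall x, `|g x| <= M) ->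
  P.-integrable setT (EFin \o g).
Proof.
move=> mg gM; apply: measurable_bounded_integrable => //.
- by rewrite (le_lt_trans (probability_le1 _ _)) ?ltry.
- exact: bounded_funP gM.
Qed.

Lemma integrable_boundedM (g phi : T -> R) (M : R) :
  measurable_fun setT g -> (forall x, `|g x| <= M) ->
  P.-integrable setT (EFin \o phi) ->
  P.-integrable setT (EFin \o (fun x => g x * phi x)).
Proof. by move=> mg gM; apply: integrableMr => //; exact: bounded_funP gM. Qed.

Lemma integrable_lin (a b : R) (phi psi : T -> R) :
  P.-integrable setT (EFin \o phi) -> P.-integrable setT (EFin \o psi) ->
  P.-integrable setT (EFin \o (fun x => a * phi x + b * psi x)).
Proof.
move=> iphi ipsi.
exact: (integrableD measurableT (integrableZl measurableT a iphi)
                                (integrableZl measurableT b ipsi)).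
Qed.

Lemma Rintegral_lin (a b : R) (phi psi : T -> R) :
  P.-integrable setT (EFin \o phi) -> P.-integrable setT (EFin \o psi) ->
  \int[P]_x (a * phi x + b * psi x) =
  a * \int[P]_x phi x + b * \int[P]_x psi x.
Proof.
move=> iphi ipsi; rewrite RintegralD ?RintegralZl//.
- exact: (integrableZl measurableT a iphi).
- exact: (integrableZl measurableT b ipsi).
Qed.

Lemma EFin_Rintegral (phi : T -> R) : P.-integrable setT (EFin \o phi) ->
  (\int[P]_x phi x)%:E = (\int[P]_x (phi x)%:E)%E.
Proof. by move=> iphi; rewrite fineK//; exact: integrable_fin_num. Qed.

Lemma Rintegral_cstT (r : R) : \int[P]_x r = r.
Proof. by rewrite Rintegral_cst//= (@probability_setT _ _ _ P) mulr1. Qed.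

Lemma integrable_cstT (r : R) : P.-integrable setT (EFin \o (fun=> r)).
Proof. exact: finite_measure_integrable_cst. Qed.

Lemma integrable_norm_sub (phi psi : T -> R) :
  P.-integrable setT (EFin \o phi) -> P.-integrable setT (EFin \o psi) ->
  P.-integrable setT (EFin \o (fun x => `|phi x - psi x|)).
Proof.
move=> iphi ipsi.
have := @integrable_norm _ _ _ P setT (fun x => phi x - psi x); apply.
exact: (@integrableB _ _ _ P setT _ (EFin \o phi) (EFin \o psi)).
Qed.

Lemma measurable_integrable (phi : T -> R) :
  P.-integrable setT (EFin \o phi) -> measurable_fun setT phi.
Proof. by move=> /measurable_int/measurable_EFinP. Qed.

End bounded_functions.

(** * Uniqueness for bounded functionals on L^1(P) *)

Section L1_functional.
Context d (T : measurableType d) (R : realType) (P : probability T R).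
Variables (I : (T -> R) -> R) (K : R).
Hypothesis I_lin : forall (a b : R) (phi psi : T -> R),
  P.-integrable setT (EFin \o phi) -> P.-integrable setT (EFin \o psi) ->
  I (fun x => a * phi x + b * psi x) = a * I phi + b * I psi.
Hypothesis I_bnd : forall phi : T -> R, P.-integrable setT (EFin \o phi) ->
  `|I phi| <= K * \int[P]_x `|phi x|.

Let I0 : I (fun=> 0) = 0.
Proof.
have := I_lin 0 0 (integrable_cstT P 0) (integrable_cstT P 0).
by rewrite /= !mul0r !addr0.
Qed.

Let I_sum n (c : nat -> R) (F : nat -> T -> R) :
  (forall i, P.-integrable setT (EFin \o F i)) ->
  P.-integrable setT (EFin \o (fun x => \sum_(i < n) c i * F i x)) /\
  I (fun x => \sum_(i < n) c i * F i x) = \sum_(i < n) c i * I (F i).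
Proof.
move=> iF; elim: n => [|n [IHi IH]].
  under eq_fun do rewrite big_ord0.
  by rewrite big_ord0; split => //; exact: (integrable_cstT P 0).
have -> : (fun x => \sum_(i < n.+1) c i * F i x) =
    (fun x => 1 * (\sum_(i < n) c i * F i x) + c n * F n x).
  by apply/funext => x; rewrite big_ord_recr /= mul1r.
split; first exact: integrable_lin.
by rewrite I_lin// IH mul1r big_ord_recr.
Qed.

Import HBSimple.

(** Linearity kills [I] on simple functions, these are dense in L^1(P), and the bound [I_bnd] makes
    [I] continuous. *)
Lemma L1_functional_eq0 : (forall A, measurable A -> I \1_A = 0) ->
  forall phi : T -> R, P.-integrable setT (EFin \o phi) -> I phi = 0.
Proof.
move=> Iind0 phi iphi.
have Is0 (s : {sfun T >-> R}) : I s = 0.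
  pose r := finmap.enum_fset (fset_set (range s)).
  have -> : (s : T -> R) =
      (fun x => \sum_(i < size r) r`_i * \1_(s @^-1` [set r`_i]) x).
    by apply/funext => x; rewrite fimfunEord.
  have mA y : measurable (s @^-1` [set y]).
    exact: measurable_sfunP.
  have iA i : P.-integrable setT (EFin \o (\1_(s @^-1` [set r`_i]) : T -> R)).
    exact: integrable_indic.
  rewrite (I_sum (size r) (fun i => r`_i) iA).2.
  by rewrite big1// => i _; rewrite Iind0 ?mulr0.
have [s [is_ _ sphi]] := approximation_sfun_integrable measurableT iphi.
(* As [I] vanishes on [s n], it takes the same value at [phi] and at [phi - s n], whose L^1 norm
   tends to 0. *)
have K_s n : `|I phi| <= K * \int[P]_x `|phi x - s n x|.
  have -> : I phi = I (fun x => 1 * phi x + (-1) * s n x).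
    by rewrite I_lin// Is0 mul1r mulr0 addr0.
  apply: le_trans (I_bnd _) _; first exact: integrable_lin.
  rewrite le_eqVlt; apply/orP; left; apply/eqP; congr (_ * _).
  by apply: eq_Rintegral => x _; rewrite mul1r mulN1r.
apply/eqP; rewrite -normr_le0; apply/ler_addgt0Pr => e e0; rewrite add0r.
have : (fun n => K * \int[P]_x `|phi x - s n x|) @ \oo --> (0 : R).
  rewrite -(mulr0 K); apply: cvgM; first exact: cvg_cst.
  exact: (fine_cvg sphi).
move/cvgrPdist_le => /(_ e e0) [N _ /(_ N (leqnn N))] /=.
rewrite sub0r normrN => /(le_trans (ler_norm _)); exact: le_trans.
Qed.

End L1_functional.

(** On [A] the function [h] agrees a.e. with its absolute value, so a nonpositive integral forces
    [h = 0] a.e. on [A]. With [0 < h] a.e. on [A], almost no point is left in [A]. *)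
Lemma null_of_integral_le0 d (T : measurableType d) (R : realType)
  (P : probability T R) (A : set T) (h : T -> R) :
  measurable A -> P.-integrable setT (EFin \o h) ->
  {ae P, forall x, A x -> 0 < h x} ->
  (\int[P]_(x in A) (h x)%:E <= 0)%E -> P A = 0.
Proof.
move=> mA ih h0 hA0.
have mh : measurable_fun A (EFin \o h).
  by apply: measurable_funTS; exact: measurable_int ih.
have absh0 : (\int[P]_(x in A) `|(h x)%:E| = 0)%E.
  apply/eqP; rewrite eq_le integral_ge0// andbT; apply: le_trans hA0.
  rewrite le_eqVlt; apply/orP; left; apply/eqP; apply: ae_eq_integral => //.
  - exact: measurableT_comp.
  - by apply: filterS h0 => x h0 /h0 hx; rewrite /= gtr0_norm.
have h_eq0 := (ae_eq_integral_abs P mA mh).1 absh0.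
have nA : {ae P, forall x, ~ A x}.
  apply: (filterS2 _ _ h0 h_eq0) => x hx hx0 Ax.
  by have := hx Ax; have [->] := hx0 Ax; rewrite ltxx.
by apply/negligibleP => //; apply: negligibleS nA => x Ax /=; exact.
Qed.

(** * The dual of L^1(P): representation by a bounded function *)

Section L1_dual.
Context d (T : measurableType d) (R : realType) (P : probability T R).
Variables (I : (T -> R) -> R) (K : R).
Hypothesis I_lin : forall (a b : R) (phi psi : T -> R),
  P.-integrable setT (EFin \o phi) -> P.-integrable setT (EFin \o psi) ->
  I (fun x => a * phi x + b * psi x) = a * I phi + b * I psi.
Hypothesis I_bnd : forall phi : T -> R, P.-integrable setT (EFin \o phi) ->
  `|I phi| <= K * \int[P]_x `|phi x|.

Let I0 : I (fun=> 0) = 0.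
Proof.
have := I_lin 0 0 (integrable_cstT P 0) (integrable_cstT P 0).
by rewrite /= !mul0r !addr0.
Qed.

Let indic_int (A : set T) : measurable A ->
  P.-integrable setT (EFin \o (\1_A : T -> R)).
Proof. exact: integrable_indic. Qed.

Let Rint_indic (A : set T) : measurable A ->
  \int[P]_x `|\1_A x : R| = fine (P A).
Proof.
move=> mA; rewrite /Rintegral; congr fine.
rewrite -[in RHS](setIT A) -[in RHS](integral_indic P measurableT mA).
by apply: eq_integral => x _; rewrite ger0_norm.
Qed.

Let I_indic_bnd (A : set T) : measurable A -> `|I \1_A| <= K * fine (P A).
Proof. by move=> mA; rewrite -Rint_indic//; exact/I_bnd/indic_int. Qed.

Let nu (A : set T) : \bar R := (I \1_A)%:E.

Let nu0 : nu set0 = 0%E.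
Proof.
by rewrite /nu (_ : \1_set0 = fun=> 0) ?I0//; apply/funext => x; rewrite indic0.
Qed.

Let I_indicU (A B : set T) : measurable A -> measurable B -> A `&` B = set0 ->
  I \1_(A `|` B) = I \1_A + I \1_B.
Proof.
move=> mA mB AB0; have := I_lin 1 1 (indic_int mA) (indic_int mB).
rewrite !mul1r => <-; congr I; apply/funext => x; rewrite !mul1r !indicE in_setU.
case: (boolP (x \in A)) => xA; case: (boolP (x \in B)) => xB /=;
  rewrite ?addr0 ?add0r//.
have : (A `&` B) x by split; apply/set_mem.
by rewrite AB0.
Qed.

Let nu_additive (F : (set T)^nat) : (forall i, measurable (F i)) ->
  trivIset setT F ->
  forall n, I \1_(\big[setU/set0]_(i < n) F i) = \sum_(i < n) I \1_(F i).
Proof.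
move=> mF tF; elim=> [|n IH].
  by rewrite !big_ord0; exact: (congr1 fine nu0).
rewrite !big_ord_recr/= I_indicU ?IH//; first exact: bigsetU_measurable.
rewrite big_distrl/= big1// => i _.
have /trivIsetP := tF; apply => //.
by rewrite neq_ltn ltn_ord.
Qed.

(** Finite additivity reduces the error after [n] sets to [I] on the indicator of the tail
    [U \ s n]. This is at most [K] times the measure of the tail, which tends to 0 by continuity of
    [P] from below. *)
Let nu_sigma_additive : semi_sigma_additive nu.
Proof.
move=> F mF tF mU; set U := \bigcup_n F n.
pose s n := \big[setU/set0]_(i < n) F i.
have ms n : measurable (s n) by exact: bigsetU_measurable.
have sU n : s n `<=` U by exact: bigsetU_bigcup.
have sE n : \sum_(0 <= i < n) nu (F i) = (I \1_(s n))%:E.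
  by rewrite big_mkord /nu sumEFin nu_additive.
have PsU : (fun n => fine (P (s n))) @ \oo --> fine (P U).
  apply: fine_cvg; rewrite fineK ?fin_num_measure//.
  have := @measure_semi_sigma_additive _ _ _ P F mF tF mU.
  by under eq_fun do rewrite big_mkord -measure_bigsetU//.
have IU n : I \1_U - I \1_(s n) = I \1_(U `\` s n).
  have := @I_indicU (s n) (U `\` s n) (ms n) (measurableD mU (ms n)) (setDIK _ _).
  by rewrite (setDUK (sU n)) => ->; rewrite addrAC subrr add0r.
have cvI : (fun n => I \1_(s n)) @ \oo --> I \1_U.
  apply/cvgrPdist_le => e e0.
  have : (fun n => K * (fine (P U) - fine (P (s n)))) @ \oo --> (0 : R).
    rewrite -(mulr0 K) -(subrr (fine (P U))).
    by apply: cvgM; [exact: cvg_cst|apply: cvgB => //; exact: cvg_cst].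
  move/cvgrPdist_le => /(_ e e0); apply: filterS => n.
  rewrite sub0r normrN => /(le_trans (ler_norm _)); apply: le_trans.
  rewrite IU; apply: (le_trans (I_indic_bnd (measurableD mU (ms n)))).
  rewrite -fineB ?fin_num_measure// measureD ?(setIidr (sU n)) //.
  by rewrite ltey_eq fin_num_measure.
rewrite (_ : (fun n => _) = EFin \o (fun n => I \1_(s n))); last first.
  by apply/funext => n; exact: sE.
by apply: cvg_EFin; [exact: nearW|exact: cvI].
Qed.

(** The charge [A |-> I \1_A] is absolutely continuous because it is bounded by [K] times [P]. The
    same bound confines its Radon-Nikodym derivative [r] to [[- K, K]] a.e., and a truncation of [r]
    represents [I], first on indicators and then everywhere. *)
Lemma L1_dual_repr : exists g : T -> R, [/\ measurable_fun setT g,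
  exists M : R, forall x, `|g x| <= M &
  forall phi : T -> R, P.-integrable setT (EFin \o phi) ->
    I phi = \int[P]_x (g x * phi x)].
Proof.
pose ch : {charge set T -> \bar R} := HB.pack nu
  (isCharge.Build _ _ _ nu nu0 (fun A _ => erefl) nu_sigma_additive).
have numu : ch `<< P.
  apply/null_content_dominatesP => A mA PA0.
  have := I_indic_bnd mA; rewrite PA0/= mulr0 normr_le0 => /eqP I0'.
  by rewrite /= /nu I0'.
pose r x := fine (Radon_Nikodym ch P x).
have rE x : (r x)%:E = Radon_Nikodym ch P x.
  by rewrite fineK//; exact: Radon_Nikodym_fin_num.
have ir : P.-integrable setT (EFin \o r).
  have -> : EFin \o r = Radon_Nikodym ch P by apply/funext => x; exact: rE.
  exact: Radon_Nikodym_integrable.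
have mr := measurable_integrable ir.
have Ir A : measurable A -> (I \1_A)%:E = (\int[P]_(x in A) (r x)%:E)%E.
  move=> mA; under eq_integral do rewrite rE.
  exact: (Radon_Nikodym_integral numu mA).
(* Taking [a = 1] and [a = -1] treats the two sides of [[- K, K]] at once: the integral of
   [a * r - K] over [A] is [a * I \1_A - K * P A], which is nonpositive, while the integrand is
   positive on [A]. *)
have nullp (a : R) (A : set T) : `|a| = 1 -> measurable A ->
    (forall x, A x -> K < a * r x) -> P A = 0.
  move=> a1 mA rK.
  apply: (@null_of_integral_le0 _ _ _ _ _ (fun x => a * r x + (-1) * K)) => //.
  - exact: (integrable_lin a (-1) ir (integrable_cstT P K)).
  - by apply: aeW => x /rK; rewrite mulN1r subr_gt0.
  have irA : P.-integrable A (EFin \o r) by exact: integrableS ir.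
  have iKA : P.-integrable A (EFin \o (fun=> - K)).
    exact: finite_measure_integrable_cst.
  under eq_integral do rewrite mulN1r EFinD EFinM.
  rewrite integralD//; last exact: integrableZl.
  have -> : (\int[P]_(x in A) (- K)%:E)%E = (- K * fine (P A))%:E.
    by rewrite integral_cst// EFinM fineK// fin_num_measure.
  rewrite integralZl// -Ir// -!EFinM -EFinD lee_fin mulNr subr_le0.
  apply: le_trans (ler_norm _) _; rewrite normrM a1 mul1r.
  exact: I_indic_bnd.
pose B := r @^-1` `[- K, K].
have mB : measurable B.
  by rewrite -[B]setTI; apply: mr => //; exact: measurable_itv.
(* Cutting [r] to 0 outside [B] turns the a.e. bound into one valid at every point. The bound is
   written [|K|] because [K] has no prescribed sign. *)
pose g x := r x * \1_B x.
have mg : measurable_fun setT g.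
  by apply: measurable_funM => //; exact: measurable_indic.
have gK x : `|g x| <= `|K|.
  rewrite /g indicE; case: (boolP (x \in B)) => [/set_mem|_]; last first.
    by rewrite mulr0 normr0.
  rewrite /B/= in_itv/= -ler_norml mulr1 => /le_trans; apply; exact: ler_norm.
have rg : ae_eq P setT (EFin \o r) (EFin \o g).
  have mAp : measurable (r @^-1` `]K, +oo[).
    by rewrite -[_ @^-1` _]setTI; apply: mr => //; exact: measurable_itv.
  have mAm : measurable (r @^-1` `]-oo, - K[).
    by rewrite -[_ @^-1` _]setTI; apply: mr => //; exact: measurable_itv.
  exists (r @^-1` `]K, +oo[ `|` r @^-1` `]-oo, - K[); split.
  - exact: measurableU.
  - apply: null_set_setU => //.
    + apply: (@nullp 1) => //; first by rewrite normr1.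
      by move=> x /=; rewrite in_itv/= andbT mul1r.
    + apply: (@nullp (-1)) => //; first by rewrite normrN1.
      by move=> x /=; rewrite in_itv/= mulN1r ltrNr.
  - move=> x /= /not_implyP[_]; rewrite /g indicE.
    case: (boolP (x \in B)) => [_|/negP xB _]; first by rewrite mulr1.
    have [Kr|rK] := ltP K (r x); first by left; rewrite /= in_itv/= andbT.
    right; rewrite /= in_itv/= ltNge; apply/negP => Kr; apply: xB.
    by apply/mem_set; rewrite /B/= in_itv/= Kr rK.
exists g; split => //; first by exists `|K|.
have gM_int (phi : T -> R) := @integrable_boundedM _ _ _ P g phi _ mg gK.
move=> phi iphi; apply/eqP; rewrite -subr_eq0; apply/eqP.
(* The difference of the two functionals is linear, bounded with constant [K + |K|], and zero on
   indicators. *)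
apply: (@L1_functional_eq0 _ _ _ P (fun phi => I phi - \int[P]_x (g x * phi x))
  (K + `|K|)) => //.
- move=> a b u v iu iv.
  rewrite I_lin//.
  have -> : \int[P]_x (g x * (a * u x + b * v x)) =
      \int[P]_x (a * (g x * u x) + b * (g x * v x)).
    by apply: eq_Rintegral => x _; rewrite mulrDr mulrCA (mulrCA (g x)).
  by rewrite Rintegral_lin; [lra|exact: gM_int|exact: gM_int].
- move=> u iu; apply: le_trans (ler_normB _ _) _; rewrite mulrDl lerD ?I_bnd//.
  apply: le_trans (le_normr_Rintegral _ _) _ => //; first exact: gM_int.
  have inu := integrable_norm iu.
  rewrite -RintegralZl//; apply: le_Rintegral => //.
  + exact: (integrable_norm (gM_int _ iu)).
  + exact: (integrableZl measurableT `|K| inu).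
  + by move=> x _; rewrite normrM ler_wpM2r.
- move=> A mA; apply/eqP; rewrite subr_eq0; apply/eqP; apply: EFin_inj.
  rewrite EFin_Rintegral; last exact/gM_int/integrable_indic.
  rewrite Ir// integral_mkcond.
  rewrite [RHS](_ : _ = (\int[P]_x ((EFin \o g) \_ A) x)%E); last first.
    apply: eq_integral => x _; rewrite patchE indicE.
    by case: ifP => _; rewrite ?mulr1 ?mulr0.
  rewrite -!integral_mkcond; apply: ae_eq_integral => //.
  + exact/measurable_funTS/measurable_EFinP.
  + exact/measurable_funTS/measurable_EFinP.
  + exact: ae_eq_subset rg.
Qed.

End L1_dual.

(** * Continuous linear functionals on centred integrable functions *)

Section L1_0_representation.
Context d (T : measurableType d) (R : realType) (P : probability T R).

Lemma integrable_sub (phi psi : T -> R) :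
  P.-integrable setT (EFin \o phi) -> P.-integrable setT (EFin \o psi) ->
  P.-integrable setT (EFin \o (fun x => phi x - psi x)).
Proof. by move=> iphi ipsi; exact: (integrableB measurableT iphi ipsi). Qed.

Lemma l1distE (phi psi : T -> R) :
  P.-integrable setT (EFin \o phi) -> P.-integrable setT (EFin \o psi) ->
  l1dist P phi psi = (\int[P]_x `|phi x - psi x|)%:E.
Proof.
by move=> iphi ipsi; rewrite EFin_Rintegral//; exact: integrable_norm_sub.
Qed.

Lemma L1_0P (eta : T -> R) :
  L1_0 P eta <-> P.-integrable setT (EFin \o eta) /\ \int[P]_x eta x = 0.
Proof.
split=> -[ieta eta0]; split=> //; first by rewrite /Rintegral eta0.
by rewrite -EFin_Rintegral// eta0.
Qed.

Lemma L1_0_center (phi : T -> R) : P.-integrable setT (EFin \o phi) ->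
  L1_0 P (fun x => phi x - \int[P]_y phi y).
Proof.
move=> iphi; apply/L1_0P; split.
  by apply: integrable_sub => //; exact: integrable_cstT.
by rewrite RintegralB ?Rintegral_cstT ?subrr//; exact: integrable_cstT.
Qed.

(** Precomposing [D] with centring extends it to all of L^1(P), where duality applies. The extension
    kills constants, and its value at 1 is the integral of [g], so [g] has mean 0. *)
Lemma cont_linear_L1_0_repr (D : (T -> R) -> R) : cont_linear_L1_0 P D ->
  exists g : T -> R, [/\ measurable_fun setT g,
    exists M : R, forall x, `|g x| <= M,
    \int[P]_x g x = 0 &
    forall eta, L1_0 P eta -> D eta = \int[P]_x (g x * eta x)].
Proof.
move=> [_ Dlin [C DC]].
have i1 := integrable_cstT P 1.
pose I phi := D (fun x : T => phi x - \int[P]_y phi y).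
have I_lin (a b : R) (phi psi : T -> R) :
    P.-integrable setT (EFin \o phi) -> P.-integrable setT (EFin \o psi) ->
    I (fun x => a * phi x + b * psi x) = a * I phi + b * I psi.
  move=> iphi ipsi; rewrite /I -Dlin; [|exact: L1_0_center..].
  by rewrite Rintegral_lin//; congr D; apply/funext => x; lra.
(* The factor 2 is the cost of centring: subtracting the mean at most doubles the L^1 norm. *)
have I_bnd (phi : T -> R) : P.-integrable setT (EFin \o phi) ->
    `|I phi| <= (`|C| * 2) * \int[P]_x `|phi x|.
  move=> iphi; have [/= ic _] := L1_0_center iphi.
  have := DC _ (L1_0_center iphi).
  rewrite l1distE//; last exact: integrable_cstT.
  rewrite -EFinM lee_fin => /le_trans; apply.
  apply: le_trans (ler_wpM2r _ (ler_norm C)) _; first exact: Rintegral_ge0.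
  have inphi := integrable_norm iphi.
  rewrite -mulrA ler_wpM2l// mulr_natl mulr2n.
  rewrite -{2}(Rintegral_cstT P (\int[P]_x `|phi x|)).
  rewrite -RintegralD//; last exact: integrable_cstT.
  apply: le_Rintegral => //.
  - by apply: integrable_norm_sub => //; exact: integrable_cstT.
  - exact: (integrableD measurableT inphi (integrable_cstT P _)).
  - move=> x _; rewrite subr0 (le_trans (ler_normB _ _))// lerD2l.
    exact: le_normr_Rintegral.
have [g [mg [M gM] gI]] := L1_dual_repr I_lin I_bnd.
exists g; split => //; first by exists M.
  have z0 : L1_0 P (fun=> 0).
    by apply/L1_0P; rewrite Rintegral_cstT; split => //; exact: integrable_cstT.
  have D0 : D (fun=> 0) = 0.
    by have := Dlin 0 0 _ _ z0 z0; rewrite /= !mul0r !addr0.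
  have := gI _ i1; rewrite /I /= Rintegral_cstT subrr D0 => ->.
  by apply: eq_Rintegral => x _; rewrite mulr1.
move=> eta eta0; have /L1_0P[ieta e0] := eta0; rewrite -gI// /I e0.
by congr D; apply/funext => x; rewrite subr0.
Qed.

End L1_0_representation.

(** * Densities, the probabilities they define, and laws *)

Section densities_and_laws.
Context d (T : measurableType d) (R : realType) (P : probability T R).

Lemma densities1 : densities P (fun=> 1).
Proof.
split; first exact: integrable_cstT.
- by apply: aeW => x; exact: ltr01.
- by rewrite -EFin_Rintegral ?Rintegral_cstT//; exact: integrable_cstT.
Qed.

Lemma densities_probability (L : T -> R) : densities P L ->
  exists m : probability T R, forall A, measurable A ->
    m A = (\int[P]_(x in A) (L x)%:E)%E.
Proof.
move=> [iL L0 L1].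
have mL := measurable_integrable iL.
(* [L] is positive only a.e.; its positive part is nonnegative everywhere, as needed for a measure,
   and has the same integrals. *)
pose m0 A := (\int[P]_(x in A) (Num.max (L x) 0)%:E)%E.
have mmax : measurable_fun setT (EFin \o (fun x => Num.max (L x) 0)).
  by apply/measurable_EFinP; exact: measurable_maxr.
have m0E A : measurable A -> m0 A = (\int[P]_(x in A) (L x)%:E)%E.
  move=> mA; apply: ae_eq_integral => //; [exact: measurable_funTS|
    exact/measurable_funTS/measurable_EFinP|].
  by apply: filterS L0 => x Lx _; rewrite max_l// ltW.
have m00 : m0 set0 = 0%E by rewrite /m0 integral_set0.
have m0ge0 A : (0 <= m0 A)%E.
  by apply: integral_ge0 => x _; rewrite lee_fin le_max lexx orbT.
have m0s : semi_sigma_additive m0.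
  apply: semi_sigma_additive_nng_induced => // x.
  by rewrite lee_fin le_max lexx orbT.
pose m1 : {measure set T -> \bar R} :=
  HB.pack m0 (isMeasure.Build _ _ _ m0 m00 m0ge0 m0s).
have m1T : m1 setT = 1%E by rewrite /= m0E.
pose m : probability T R :=
  HB.pack m0 m1 (Measure_isProbability.Build _ _ _ m1 m1T).
by exists m => A mA; exact: m0E.
Qed.

(** The Radon-Nikodym derivative of [m] and [L] have the same integral over every measurable set, so
    they agree a.e.; the formula is then the change of variables. *)
Lemma Rintegral_density (m : probability T R) (L psi : T -> R) (M : R) :
  P.-integrable setT (EFin \o L) ->
  (forall A, measurable A -> m A = (\int[P]_(x in A) (L x)%:E)%E) ->
  measurable_fun setT psi -> (forall x, `|psi x| <= M) ->
  \int[m]_x psi x = \int[P]_x (psi x * L x).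
Proof.
move=> iL mE mpsi psiM.
have mL := measurable_integrable iL.
have mP : m `<< P.
  apply/null_content_dominatesP => A mA PA0; rewrite mE//.
  by apply: null_set_integral => //; exact/measurable_funTS/measurable_EFinP.
rewrite /Rintegral; congr fine.
rewrite -(Radon_Nikodym_change_of_variables mP measurableT
  (integrable_bounded m mpsi psiM)).
have iRN : P.-integrable setT (Radon_Nikodym (charge_of_finite_measure m) P).
  exact: Radon_Nikodym_integrable.
apply: ae_eq_integral => //.
- by apply: emeasurable_funM; [exact/measurable_EFinP|exact: measurable_int iRN].
- by apply/measurable_EFinP; exact: measurable_funM.
have : ae_eq P setT (Radon_Nikodym (charge_of_finite_measure m) P) (EFin \o L).
  apply: integral_ae_eq => //; first exact/measurable_EFinP.
  by move=> E _ mEE; rewrite -mE// -Radon_Nikodym_integral.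
by apply: filterS => x /= /(_ I) ->.
Qed.

Context d' (Y : measurableType d') (X : T -> Y).
Hypothesis mX : measurable_fun setT X.

Lemma measurable_preimageT (A : set Y) : measurable A -> measurable (X @^-1` A).
Proof. by move=> mA; rewrite -[_ @^-1` _]setTI; exact: mX. Qed.

(** The expansion in [is_derivative] is quantified over probabilities that are laws, so exploiting
    it requires exhibiting one: the image under [X] of the probability with density [L]. *)
Lemma law_exists (L : T -> R) : densities P L ->
  exists nu : probability Y R, forall A, measurable A ->
    nu A = (\int[P]_(x in X @^-1` A) (L x)%:E)%E.
Proof.
move=> /densities_probability[m mE].
pose Xm : {mfun T >-> Y} := HB.pack X (isMeasurableFun.Build _ _ _ _ X mX).
exists (distribution m Xm) => A mA.
by rewrite -mE//; exact: measurable_preimageT.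
Qed.

Lemma Rintegral_law (nu : probability Y R) (L : T -> R) (g : Y -> R) (M : R) :
  densities P L ->
  (forall A, measurable A -> nu A = (\int[P]_(x in X @^-1` A) (L x)%:E)%E) ->
  measurable_fun setT g -> (forall y, `|g y| <= M) ->
  \int[nu]_y g y = \int[P]_x (g (X x) * L x).
Proof.
move=> dL nuE mg gM; have [m mE] := densities_probability dL.
pose Xm : {mfun T >-> Y} := HB.pack X (isMeasurableFun.Build _ _ _ _ X mX).
have mgX : measurable_fun setT (g \o X) by exact: measurableT_comp.
have [iL _ _] := dL.
rewrite -(Rintegral_density iL mE mgX (fun x => gM (X x))).
rewrite /Rintegral; congr fine.
rewrite (@eq_measure_integral _ _ _ _ (distribution m Xm)); last first.
  move=> A mA _; apply: etrans (nuE A mA) _; rewrite -mE//.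
  exact: measurable_preimageT.
rewrite integral_distribution//; first exact/measurable_EFinP.
exact: (integrable_bounded m mgX (fun x => gM (X x))).
Qed.

End densities_and_laws.

(** * Composition with a measurable map as an isometry from L^1 of its law *)

Section law_of_measurable_map.
Context d (T : measurableType d) d' (Y : measurableType d') (R : realType).
Context (P : probability T R) (X : T -> Y) (mu : probability Y R).
Hypothesis mX : measurable_fun setT X.
Hypothesis muE : forall B, measurable B -> mu B = P (X @^-1` B).

Lemma integrable_comp_law (phi : Y -> R) :
  mu.-integrable setT (EFin \o phi) -> P.-integrable setT (EFin \o (phi \o X)).
Proof.
move=> iphi; have mphi := measurable_integrable iphi.
pose Xm : {mfun T >-> Y} := HB.pack X (isMeasurableFun.Build _ _ _ _ X mX).
apply/integrableP; split.
  by apply/measurable_EFinP; exact: measurableT_comp.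
move/integrableP : iphi => [_]; apply: le_lt_trans.
rewrite (@eq_measure_integral _ _ _ _ (distribution P Xm)); last first.
  by move=> A mA _; exact: muE.
rewrite ge0_integral_distribution//.
by apply: measurableT_comp => //; exact/measurable_EFinP.
Qed.

Lemma integral_comp_law (phi : Y -> R) (B : set Y) : measurable B ->
  mu.-integrable setT (EFin \o phi) ->
  (\int[mu]_(y in B) (phi y)%:E = \int[P]_(x in X @^-1` B) (phi (X x))%:E)%E.
Proof.
move=> mB iphi; have mphi := measurable_int _ iphi.
pose Xm : {mfun T >-> Y} := HB.pack X (isMeasurableFun.Build _ _ _ _ X mX).
rewrite (@eq_measure_integral _ _ _ _ (distribution P Xm)); last first.
  by move=> A mA _; exact: muE.
rewrite (integral_pushforward mX mphi)//.
apply: integrableS (integrable_comp_law iphi) => //.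
exact: measurable_preimageT.
Qed.

Lemma Rintegral_comp_law (phi : Y -> R) :
  mu.-integrable setT (EFin \o phi) ->
  \int[P]_x phi (X x) = \int[mu]_y phi y.
Proof. by move=> iphi; rewrite /Rintegral integral_comp_law. Qed.

Lemma L1_0_comp_law (phi : Y -> R) : L1_0 mu phi -> L1_0 P (phi \o X).
Proof.
move=> /L1_0P[iphi phi0]; apply/L1_0P; split; first exact: integrable_comp_law.
by rewrite Rintegral_comp_law.
Qed.

Lemma l1dist_comp_law (phi psi : Y -> R) :
  mu.-integrable setT (EFin \o phi) -> mu.-integrable setT (EFin \o psi) ->
  l1dist P (phi \o X) (psi \o X) = l1dist mu phi psi.
Proof.
move=> iphi ipsi; rewrite !l1distE//; [|exact: integrable_comp_law..].
congr _%:E.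
have /Rintegral_comp_law <- // := integrable_norm_sub iphi ipsi.
Qed.

(** Composition with [X] is linear, preserves means and L^1 distances, and pulls null sets of [mu]
    back to null sets of [P]. *)
Lemma cont_linear_L1_0_comp_law (D : (T -> R) -> R) :
  cont_linear_L1_0 P D -> cont_linear_L1_0 mu (fun phi => D (phi \o X)).
Proof.
move=> [Dae Dlin [C DC]]; split.
- move=> phi psi phi0 psi0 [N [mN N0 phipsi]].
  apply: Dae; [exact: L1_0_comp_law..|].
  exists (X @^-1` N); split; first exact: measurable_preimageT.
    exact: etrans (esym (muE mN)) N0.
  by move=> x /= ?; exact: phipsi.
- by move=> a b phi psi phi0 psi0; rewrite -Dlin//; exact: L1_0_comp_law.
- exists C => phi phi0; have [iphi _] := phi0.
  have := DC _ (L1_0_comp_law phi0).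
  have -> : l1dist P (phi \o X) (fun=> 0) = l1dist mu phi (fun=> 0).
    by apply: (@l1dist_comp_law phi (fun=> 0)) => //; exact: integrable_cstT.
  by [].
Qed.

End law_of_measurable_map.

(** * Uniqueness of the derivative at the density 1 *)

Section differentiability.
Context d (T : measurableType d) (R : realType) (n : nat).
Context (P : probability T R) (X : T -> Rd R n).
Context (f : probability (Rd R n) R -> R).
Hypothesis mX : measurable_fun setT X.

Lemma is_lawP (nu : probability (Rd R n) R) : is_law P (fun=> 1) X nu <->
  forall B, measurable B -> nu B = P (X @^-1` B).
Proof.
have E B : measurable B -> (\int[P]_(x in X @^-1` B) 1%:E)%E = P (X @^-1` B).
  by move=> mB; rewrite integral_cst ?mul1e//; exact: measurable_preimageT.
by split=> nuE B mB; rewrite nuE// E.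
Qed.

(* For bounded eta, 1 + t eta is a density for small t, so the derivative at
   eta is a genuine directional derivative. *)
Lemma is_derivative_bounded_unique (D1 D2 : (T -> R) -> R) (eta : T -> R)
  (M : R) : is_derivative P X f (fun=> 1) D1 ->
  is_derivative P X f (fun=> 1) D2 ->
  L1_0 P eta -> (forall x, `|eta x| <= M) -> D1 eta = D2 eta.
Proof.
move=> [[_ D1lin _] dD1] [[_ D2lin _] dD2] eta0 etaM.
have [ieta eta_0] := (L1_0P P eta).1 eta0.
have ineta := integrable_norm ieta.
pose N := \int[P]_x `|eta x|.
have N0 : 0 <= N by exact: Rintegral_ge0.
apply/eqP; rewrite -subr_eq0 -normr_le0; apply/ler_addgt0Pr => e e0.
rewrite add0r.
(* [c] dominates both [|M|] and [N]. With [t = r / (2 * c)] below, [t * |M|] is at most 1/2, so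
   [1 + t * eta] is positive, and its distance [t * N] to 1 is below both radii. With
   [eps = e / (2 * c)], the two errors add up to [t * e * N / c], at most [t * e]. *)
pose c := N + `|M| + 1.
have c1 : 1 <= c by rewrite lerDr addr_ge0.
have c0 : 0 < c by exact: lt_le_trans c1.
pose eps := e / (2 * c).
have eps0 : 0 < eps by rewrite divr_gt0// mulr_gt0.
have [r1 r10 H1] := dD1 _ eps0; have [r2 r20 H2] := dD2 _ eps0.
pose r := Num.min (Num.min r1 r2) 1.
have r0 : 0 < r by rewrite !lt_min r10 r20 ltr01.
have [rr1 rr2 rl1] : [/\ r <= r1, r <= r2 & r <= 1].
  by rewrite /r !ge_min !lexx !orbT.
pose t := r / (2 * c).
have t0 : 0 < t by rewrite divr_gt0// mulr_gt0.
have tc : t * c = r / 2 by rewrite /t invfM mulrA mulfVK// gt_eqF.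
have tM : t * `|M| < 1.
  have : t * `|M| <= t * c by rewrite ler_pM2l// /c; lra.
  by rewrite tc; lra.
have tN : t * N < r.
  have : t * N <= t * c by rewrite ler_pM2l// /c; have := normr_ge0 M; lra.
  by rewrite tc; lra.
pose L x := 1 + t * eta x.
have i1 := integrable_cstT P 1.
have iL : P.-integrable setT (EFin \o L).
  have := integrable_lin 1 t i1 ieta; congr (_.-integrable _ _).
  by apply/funext => x; rewrite /L /= mulr1.
have dL : densities P L.
  split => //.
    apply: aeW => x; have := etaM x; rewrite ler_norml => /andP[+ _] => etax.
    have : - (t * `|M|) <= t * eta x.
      by rewrite -mulrN ler_pM2l// (le_trans _ etax)// lerN2 ler_norm.
    by rewrite /L; lra.
  rewrite -EFin_Rintegral//; congr _%:E.
  transitivity (\int[P]_x (1 * 1 + t * eta x)).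
    by apply: eq_Rintegral => x _; rewrite mulr1.
  by rewrite Rintegral_lin// Rintegral_cstT eta_0; lra.
have dLE : l1dist P L (fun=> 1) = (t * N)%:E.
  rewrite l1distE// -RintegralZl//; congr _%:E; apply: eq_Rintegral => x _.
  by rewrite /L addrAC subrr add0r normrM (gtr0_norm t0).
have [nu nuE] := law_exists mX dL.
have [nu0 nu0E] := law_exists mX (densities1 P).
have DL (D : (T -> R) -> R) :
    (forall (a b : R) eta1 eta2, L1_0 P eta1 -> L1_0 P eta2 ->
       D (fun x => a * eta1 x + b * eta2 x) = a * D eta1 + b * D eta2) ->
    D (fun x => L x - 1) = t * D eta.
  move=> /(_ t 0 _ _ eta0 eta0); rewrite mul0r addr0 => <-; congr D.
  by apply/funext => x; rewrite /L; lra.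
have := H1 L dL; rewrite dLE lte_fin.
move=> /(_ (lt_le_trans tN rr1) nu nu0 nuE nu0E).
rewrite (DL _ D1lin) -EFinM lee_fin => B1.
have := H2 L dL; rewrite dLE lte_fin.
move=> /(_ (lt_le_trans tN rr2) nu nu0 nuE nu0E).
rewrite (DL _ D2lin) -EFinM lee_fin => B2.
have : t * `|D1 eta - D2 eta| <= t * e.
  rewrite -{1}(gtr0_norm t0) -normrM.
  have -> : t * (D1 eta - D2 eta) =
     (f nu - f nu0 - t * D2 eta) - (f nu - f nu0 - t * D1 eta) by lra.
  apply: le_trans (ler_normB _ _) _; apply: le_trans (lerD B2 B1) _.
  have -> : eps * (t * N) + eps * (t * N) = t * (e * (N / c)).
    rewrite /eps invfM; set u := c^-1; lra.
  rewrite ler_pM2l// ler_piMr ?(ltW e0)// ler_pdivrMr// mul1r /c.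
  by have := normr_ge0 M; lra.
by rewrite ler_pM2l.
Qed.

(** Any other derivative [D] is represented by some bounded [g'] of mean 0. The difference
    [k = g' - g] is itself an admissible bounded direction, and equality of both derivatives along
    it says that the integral of [k * k] is 0, hence [g' = g] a.e. *)
Lemma derivative_is_repr (g : T -> R) (M : R) :
  measurable_fun setT g -> (forall x, `|g x| <= M) -> \int[P]_x g x = 0 ->
  is_derivative P X f (fun=> 1) (fun eta => \int[P]_x (g x * eta x)) ->
  derivative_is P X f (fun=> 1) g.
Proof.
move=> mg gM g0 dg; have ig := integrable_bounded P mg gM.
split; first by eexists; exact: dg.
- by split => //; exists M; exact: aeW.
- by rewrite -EFin_Rintegral// g0.
move=> D dD eta eta0; have [ieta _] := (L1_0P P eta).1 eta0.
have [g' [mg' [M' gM'] g'0 DE]] := cont_linear_L1_0_repr dD.1.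
have ig' := integrable_bounded P mg' gM'.
pose k x := g' x - g x.
have mk : measurable_fun setT k by exact: measurable_funB.
have kM x : `|k x| <= M' + M.
  by apply: le_trans (ler_normB _ _) _; rewrite lerD.
have ik := integrable_bounded P mk kM.
have k0 : L1_0 P k.
  by apply/L1_0P; split => //; rewrite RintegralB// g'0 g0 subrr.
have ikk := integrable_boundedM mk kM ik.
have kk0 : \int[P]_x (k x * k x) = 0.
  have /eqP := is_derivative_bounded_unique dD dg k0 kM.
  rewrite DE// -subr_eq0 -RintegralB//; first last.
  - exact: (integrable_boundedM mg gM ik).
  - exact: (integrable_boundedM mg' gM' ik).
  by under eq_Rintegral do rewrite -mulrBl; move=> /eqP.
have kae : ae_eq P setT (EFin \o (fun x => k x * k x)) (cst 0%E).
  apply/ae_eq_integral_abs => //; first exact: measurable_int ikk.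
  rewrite -[RHS](congr1 EFin kk0) EFin_Rintegral//.
  by apply: eq_integral => x _; rewrite gee0_abs// lee_fin -expr2 sqr_ge0.
rewrite DE// EFin_Rintegral; last exact: (integrable_boundedM mg' gM' ieta).
apply: ae_eq_integral => //.
- exact: measurable_int (integrable_boundedM mg' gM' ieta).
- exact: measurable_int (integrable_boundedM mg gM ieta).
apply: filterS kae => x /= /(_ I) [] /eqP; rewrite mulf_eq0 orbb subr_eq0.
by move=> /eqP -> _.
Qed.

End differentiability.

(** * Comparison of a density with the density of the law it induces *)

Lemma law_density d (T : measurableType d) d' (Y : measurableType d')
  (R : realType) (P : probability T R) (X : T -> Y) (mu nu : probability Y R)
  (L : T -> R) :
  measurable_fun setT X -> (forall B, measurable B -> mu B = P (X @^-1` B)) ->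
  densities P L ->
  (forall B, measurable B -> nu B = (\int[P]_(x in X @^-1` B) (L x)%:E)%E) ->
  exists h : Y -> R, [/\ densities mu h,
    forall B, measurable B -> nu B = (\int[mu]_(y in B) (h y)%:E)%E &
    forall (g : Y -> R) (M : R), measurable_fun setT g ->
      (forall y, `|g y| <= M) ->
      \int[mu]_y (g y * (h y - 1)) = \int[P]_x (g (X x) * (L x - 1))].
Proof.
move=> mX muE dL nuE; have [iL L0 _] := dL; have mL := measurable_integrable iL.
(* A null set of [mu] has a [P]-null preimage, over which [L] integrates to 0. *)
have numu : nu `<< mu.
  apply/null_content_dominatesP => B mB muB0; apply: etrans (nuE B mB) _.
  apply: null_set_integral; first exact: measurable_preimageT.
    exact/measurable_funTS/measurable_EFinP.
  exact: etrans (esym (muE B mB)) muB0.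
pose RN := Radon_Nikodym (charge_of_finite_measure nu) mu.
pose h y := fine (RN y).
have hE : EFin \o h = RN.
  by apply/funext => y; rewrite /= fineK//; exact: Radon_Nikodym_fin_num.
have ih : mu.-integrable setT (EFin \o h).
  by rewrite hE; exact: Radon_Nikodym_integrable.
have mh := measurable_integrable ih.
have nuh B : measurable B -> nu B = (\int[mu]_(y in B) (h y)%:E)%E.
  move=> mB; rewrite -[fun y => (h y)%:E]/(EFin \o h) hE.
  by rewrite /RN -Radon_Nikodym_integral.
exists h; split => //.
  split => //; last by rewrite -nuh// [LHS]probability_setT.
  (* Strict positivity of [h]: the integral of [L] over the preimage of [A] is [nu A], also the
     integral of [h] over [A], hence nonpositive. Since [L] is positive a.e., that preimage is
     null. *)
  pose A := h @^-1` `]-oo, 0].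
  have mA : measurable A by exact: measurable_preimageT.
  exists A; split => //.
    apply: etrans (muE A mA) _.
    apply: (null_of_integral_le0 (measurable_preimageT mX mA) iL).
      by apply: filterS L0.
    rewrite -nuE// nuh//.
    rewrite -[leRHS](@integral0 _ _ _ mu A); apply: le_integral => //.
    - exact: integrableS ih.
    - exact: integrable0.
    - by move=> y /set_mem; rewrite /A/= in_itv/= lee_fin.
  by move=> y /= /negP; rewrite -leNgt /A/= in_itv.
move=> g M mg gM.
have ig := integrable_bounded mu mg gM.
have igX := integrable_comp_law mX muE ig.
have igh := integrable_boundedM mg gM ih.
have mgX : measurable_fun setT (g \o X) by exact: measurableT_comp.
have igL := integrable_boundedM mgX (fun x => gM (X x)) iL.
under eq_Rintegral do rewrite mulrBr mulr1.
under [RHS]eq_Rintegral do rewrite mulrBr mulr1.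
rewrite !RintegralB//.
(* The integrals of [g * h] under [mu] and of [g(X) * L] under [P] are both the integral of [g]
   under [nu]. *)
rewrite -(Rintegral_density ih nuh mg gM) (Rintegral_law mX dL nuE mg gM).
by rewrite (Rintegral_comp_law mX muE ig).
Qed.

(* Testing against sign (h - 1), by duality. *)
Lemma l1dist_law_density d (T : measurableType d) d' (Y : measurableType d')
  (R : realType) (P : probability T R) (X : T -> Y) (mu : probability Y R)
  (L : T -> R) (h : Y -> R) :
  measurable_fun setT X -> densities P L -> densities mu h ->
  (forall (g : Y -> R) (M : R), measurable_fun setT g ->
     (forall y, `|g y| <= M) ->
     \int[mu]_y (g y * (h y - 1)) = \int[P]_x (g (X x) * (L x - 1))) ->
  (l1dist mu h (fun=> 1%R) <= l1dist P L (fun=> 1%R))%E.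
Proof.
move=> mX [iL _ _] [ih _ _] hL; have mh := measurable_integrable ih.
rewrite !l1distE//; [|exact: integrable_cstT..].
rewrite lee_fin.
pose B := h @^-1` `[1, +oo[.
have mB : measurable B by exact: measurable_preimageT.
pose s y : R := 2 * \1_B y - 1.
have ms : measurable_fun setT s.
  have mi : measurable_fun setT (\1_B : Y -> R) by exact: measurable_indic.
  by apply: measurable_funB => //; apply: measurable_funM.
have s1 y : `|s y| <= 1.
  by rewrite /s indicE; case: (y \in B); rewrite ler_norml /=; apply/andP; lra.
have sE y : `|h y - 1| = s y * (h y - 1).
  rewrite /s indicE; case: (boolP (y \in B)) => [/set_mem|/negP yB].
    by rewrite /B/= in_itv/= andbT => h1; rewrite ger0_norm ?subr_ge0//; lra.
  have h1 : h y < 1.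
    rewrite ltNge; apply/negP => h1; apply: yB; apply/mem_set.
    by rewrite /B/= in_itv/= h1.
  by rewrite ltr0_norm ?subr_lt0// mulr0 sub0r mulN1r.
rewrite (eq_Rintegral _ (g := fun y => s y * (h y - 1))); last first.
  by move=> y _; exact: sE.
rewrite (hL _ _ ms s1).
have iL1 := integrable_sub iL (integrable_cstT P 1).
have msX : measurable_fun setT (s \o X) by exact: measurableT_comp.
apply: le_Rintegral => //.
- exact: (integrable_boundedM msX (fun x => s1 (X x)) iL1).
- exact: (integrable_norm iL1).
- move=> x _; apply: le_trans (ler_norm _) _; rewrite normrM.
  exact: ler_piMl.
Qed.

(** * Transfer of the derivative between pairs with the same law *)

Section transfer.
Context (R : realType) (n : nat) (f : probability (Rd R n) R -> R).
Context d (T : measurableType d) (P : probability T R) (X : T -> Rd R n).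
Context d' (T' : measurableType d') (P' : probability T' R) (X' : T' -> Rd R n).
Context (mu : probability (Rd R n) R) (D : (T -> R) -> R) (g : Rd R n -> R).
Variable M : R.
Hypotheses (mX : measurable_fun setT X) (mX' : measurable_fun setT X').
Hypothesis muX : forall B, measurable B -> mu B = P (X @^-1` B).
Hypothesis muX' : forall B, measurable B -> mu B = P' (X' @^-1` B).
Hypothesis dD : is_derivative P X f (fun=> 1) D.
Hypotheses (mg : measurable_fun setT g) (gM : forall y, `|g y| <= M).
Hypothesis g0 : \int[mu]_y g y = 0.
Hypothesis Dg : forall phi, L1_0 mu phi ->
  D (phi \o X) = \int[mu]_y (g y * phi y).

Let mgX' : measurable_fun setT (g \o X').
Proof. exact: measurableT_comp. Qed.

Let gX'M x : `|(g \o X') x| <= M. Proof. exact: gM. Qed.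

(** Each density [L] on the target space is replaced by [h \o X] on the source space, which gives
    the same law, lies no further from 1, and has the same linear term. The same [delta] therefore
    serves both expansions. *)
Lemma is_derivative_transfer :
  is_derivative P' X' f (fun=> 1) (fun eta => \int[P']_x ((g \o X') x * eta x)).
Proof.
split.
  split.
  - move=> eta1 eta2 /L1_0P[i1 _] /L1_0P[i2 _] eta12.
    rewrite /Rintegral; congr fine; apply: ae_eq_integral => //.
    + exact: measurable_int (integrable_boundedM mgX' gX'M i1).
    + exact: measurable_int (integrable_boundedM mgX' gX'M i2).
    + by apply: filterS eta12 => x /= ->.
  - move=> a b eta1 eta2 /L1_0P[i1 _] /L1_0P[i2 _].
    rewrite -Rintegral_lin; [|exact: (integrable_boundedM mgX' gX'M)..].
    by apply: eq_Rintegral => x _; rewrite mulrDr (mulrCA a) (mulrCA b).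
  - exists M => eta /L1_0P[ieta _].
    rewrite l1distE//; last exact: integrable_cstT.
    rewrite -EFinM lee_fin.
    have ige := integrable_boundedM mgX' gX'M ieta.
    apply: le_trans (le_normr_Rintegral _ ige) _ => //.
    under [X in _ <= M * X]eq_Rintegral do rewrite subr0.
    have ineta := integrable_norm ieta.
    rewrite -RintegralZl//; apply: le_Rintegral => //.
    + exact: (integrable_norm ige).
    + exact: (integrableZl measurableT M ineta).
    + by move=> x _; rewrite normrM ler_wpM2r.
move=> eps eps0; have [delta delta0 Hdelta] := dD.2 _ eps0.
exists delta => // L dL Ldelta nu nu0 nuE nu0E.
have [h [dh nuh hL]] := law_density mX' muX' dL nuE.
have [ih hpos h1] := dh.
have i1 := integrable_cstT mu 1.
have hl1 := l1dist_law_density mX' dL dh hL.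
have hXl1 : l1dist P (h \o X) (fun=> 1) = l1dist mu h (fun=> 1).
  exact: (l1dist_comp_law mX muX ih i1).
have dhX : densities P (h \o X).
  split.
  - exact: (integrable_comp_law mX muX ih).
  - case: hpos => N [mN N0 hN]; exists (X @^-1` N); split.
    + exact: measurable_preimageT.
    + exact: etrans (esym (muX mN)) N0.
    + by move=> x /= hx; apply: hN.
  - by rewrite -h1 (integral_comp_law mX muX measurableT ih) preimage_setT.
have nuX : is_law P (h \o X) X nu.
  by move=> B mB; rewrite nuh// (integral_comp_law mX muX mB ih).
(* The base points of the two expansions agree because [X] under [P] and [X'] under [P'] share the
   law [mu]. *)
have nu0X : is_law P (fun=> 1) X nu0.
  apply/(is_lawP P mX) => B mB.
  rewrite -[RHS](muX mB) [RHS](muX' mB).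
  exact: (is_lawP P' mX' nu0).1 nu0E B mB.
have := Hdelta _ dhX _ nu nu0 nuX nu0X.
rewrite hXl1 => /(_ (le_lt_trans hl1 Ldelta)).
have h10 : L1_0 mu (fun y => h y - 1).
  apply/L1_0P; split; first exact: integrable_sub.
  by rewrite RintegralB// Rintegral_cstT /Rintegral h1 subrr.
have -> : D (fun x => (h \o X) x - 1) = \int[P']_x ((g \o X') x * (L x - 1)).
  by rewrite -(hL _ _ mg gM) -Dg.
(* The error obtained is [eps] times the distance from [h] to 1, enlarged here to the distance from
   [L] to 1. *)
by move=> /le_trans; apply; apply: lee_wpmul2l => //; rewrite lee_fin ltW.
Qed.

Lemma derivative_is_transfer : derivative_is P' X' f (fun=> 1) (g \o X').
Proof.
apply: (derivative_is_repr mX' mgX' gX'M); last exact: is_derivative_transfer.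
by rewrite (Rintegral_comp_law mX' muX' (integrable_bounded mu mg gM)).
Qed.

End transfer.

Theorem theorem3p1 (R : realType) (dT : measure_display)
  (Omega : topMeasurableType dT) (Q : probability Omega R)
  (HRadon : radon_space R Omega)
  (HF : completion_of_borel Q)
  (d : nat) (xi : Omega -> Rd R d) (mxi : measurable_fun setT xi)
  (f : probability (Rd R d) R -> R)
  (f_ext : forall nu1 nu2 : probability (Rd R d) R,
      (forall A : set (Rd R d), measurable A -> nu1 A = nu2 A) -> f nu1 = f nu2)
  (L : Omega -> R) (HL : densities Q L)
  (QL : probability Omega R)
  (HQL : forall A : set Omega, measurable A ->
           QL A = (\int[Q]_(x in A) (L x)%:E)%E)
  (Hdiff : differentiable_at QL xi f (fun=> 1)) :
  exists g : Rd R d -> R,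
    [/\ measurable_fun setT g,
        (exists M : R, forall y, `|g y| <= M),
        derivative_is QL xi f (fun=> 1) (g \o xi) &
        forall (Q' : probability Omega R) (L' : Omega -> R)
               (xi' : Omega -> Rd R d) (Q'L' : probability Omega R),
          measurable_fun setT xi' -> densities Q' L' ->
          (forall A : set Omega, measurable A ->
             Q'L' A = (\int[Q']_(x in A) (L' x)%:E)%E) ->
          (forall B : set (Rd R d), measurable B ->
             (\int[Q']_(x in xi' @^-1` B) (L' x)%:E)%E
             = (\int[Q]_(x in xi @^-1` B) (L x)%:E)%E) ->
          derivative_is Q'L' xi' f (fun=> 1) (g \o xi')].
Proof.
have [D dD] := Hdiff.
have [mu muE] := law_exists mxi (densities1 QL).
have muQL := (is_lawP QL mxi mu).1 muE.
(* [g] is built on the space of values, from [D] restricted to functions of [xi]. *)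
have [g [mg [M gM] g0 Dg]] :=
  cont_linear_L1_0_repr (cont_linear_L1_0_comp_law mxi muQL dD.1).
exists g; split => //; first by exists M.
  (* Transferring from [xi] under [QL] to itself shows that the derivative is a function of [xi]. *)
  exact: (derivative_is_transfer mxi mxi muQL muQL dD mg gM g0 Dg).
move=> Q' L' xi' Q'L' mxi' _ HQ'L' lawE.
apply: (derivative_is_transfer mxi mxi' muQL _ dD mg gM g0 Dg) => B mB.
apply: etrans (muQL B mB) _; rewrite HQL; last exact: measurable_preimageT.
by rewrite -lawE// HQ'L'//; exact: measurable_preimageT.
Qed.
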